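(* Let $\Delta$ be an equilateral triangle (closed region) in the plane with vertices $A,B,C$ and side length $l>0$, and let $\varphi:\Delta\to\mathbb{R}$, $\varphi(p)=|pA|\,|pB|\,|pC|$. Then the maximum value of $\varphi$ on $\Delta$ is $\frac{\sqrt3}{8}\,l^3$, and it is attained at the midpoint of each side of $\Delta$.
   Context: $|pX|$ denotes the Euclidean distance from $p$ to $X$. *)

(* Defs.v *)
From mathcomp Require Import all_boot all_order all_algebra.
From mathcomp Require Import classical_sets reals.

Set Implicit Arguments.
Unset Strict Implicit.
Unset Printing Implicit Defensive.

Import Order.TTheory GRing.Theory Num.Theory.

Local Open Scope classical_set_scope.
Local Open Scope ring_scope.

(* The norm that MathComp-Analysis puts on 'rV[R]_n is the sup norm, hence an
   explicit Euclidean distance. *)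
Definition edist (R : realType) (n : nat) (p q : 'rV[R]_n) : R :=
  Num.sqrt (\sum_(i < n) (p 0 i - q 0 i) ^+ 2).

Definition equilateral (R : realType) (A B C : 'rV[R]_2) (l : R) : Prop :=
  [/\ edist A B = l, edist B C = l & edist C A = l].

(* The closed region with vertices A, B, C: all convex combinations of the
   vertices. *)
Definition triangle (R : realType) (A B C : 'rV[R]_2) : set 'rV[R]_2 :=
  [set p | exists a b c : R,
    [/\ [/\ 0 <= a, 0 <= b & 0 <= c], a + b + c = 1
      & p = a *: A + b *: B + c *: C]].

Definition midpoint (R : realType) (n : nat) (p q : 'rV[R]_n) : 'rV[R]_n :=
  2^-1 *: (p + q).

Definition is_maximum (R : realType) (S : set R) (M : R) : Prop :=
  S M /\ ubound S M.

Definition vertex_dist_prod (R : realType) (A B C p : 'rV[R]_2) : R :=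
  edist p A * edist p B * edist p C.

(* Main.v *)
Require Import Defs.
From mathcomp Require Import all_boot all_order all_algebra.
From mathcomp Require Import classical_sets reals.
From mathcomp Require Import ring lra.

(** In barycentric coordinates [a + b + c = 1] the law of cosines gives
    |pA| = l sqrt(b^2 + bc + c^2), and cyclically, so that
    phi(p) = l^3 sqrt(P(a,b,c)) where P is the product of the three quadratic
    forms ([vertex_dist_prod_bary]).  Everything therefore reduces to the
    symmetric polynomial inequality P <= 3/64 on the simplex
    ([quad_prod_le]).  With q = ab + bc + ca and r = abc one has
    P = q^2 - q^3 - r, and
      3/64 - P = (1/4 - q) (3/16 + 3q/4 - q^2) + r.
    For q <= 1/4 both summands are nonnegative; for 1/4 < q <= 1/3 Schur's
    inequality r >= (4q - 1)/9 outweighs the negative first summand.  The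
    midpoints of the sides have coordinates (1/2, 1/2, 0) up to permutation,
    hence q = 1/4 and r = 0, and there equality holds. *)

Set Implicit Arguments.
Unset Strict Implicit.
Unset Printing Implicit Defensive.

Import Order.TTheory GRing.Theory Num.Theory.

Local Open Scope classical_set_scope.
Local Open Scope ring_scope.

(** Only the middle term is negative, and the first one absorbs it, since
    a (a - c) - b (b - c) = (a - b) (a + b - c). *)
Lemma schur_sorted (R : realFieldType) (a b c : R) :
  0 <= c -> c <= b -> b <= a ->
  0 <= a * (a - b) * (a - c) + b * (b - a) * (b - c) + c * (c - a) * (c - b).
Proof.
move=> c0 cb ba.
have -> : a * (a - b) * (a - c) + b * (b - a) * (b - c)
          + c * (c - a) * (c - b)
        = (a - b) ^+ 2 * (a + b - c) + c * ((a - c) * (b - c)) by ring.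
apply: addr_ge0; first by apply: mulr_ge0; [exact: sqr_ge0 | lra].
by rewrite !mulr_ge0 //; lra.
Qed.

Lemma schur (R : realFieldType) (a b c : R) : 0 <= a -> 0 <= b -> 0 <= c ->
  0 <= a * (a - b) * (a - c) + b * (b - a) * (b - c) + c * (c - a) * (c - b).
Proof.
move=> a0 b0 c0.
case: (lerP a b) => [ab|/ltW ab]; case: (lerP b c) => [bc|/ltW bc];
  case: (lerP a c) => [ac|/ltW ac].
- by have := schur_sorted a0 ab bc; lra.
- by have := schur_sorted a0 ab bc; lra.
- by have := schur_sorted a0 ac bc; lra.
- by have := schur_sorted c0 ac ab; lra.
- by have := schur_sorted b0 ab ac; lra.
- by have := schur_sorted b0 bc ac; lra.
- by have := schur_sorted c0 bc ab; lra.
- by have := schur_sorted c0 bc ab; lra.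
Qed.

(** The squared length of the vector x u + y v when u and v are unit vectors
    at an angle of 60 degrees. *)
Definition quad (R : realFieldType) (x y : R) : R := x ^+ 2 + x * y + y ^+ 2.

Lemma quad_ge0 (R : realFieldType) (x y : R) : 0 <= quad x y.
Proof. by have := sqr_ge0 (x + y); have := sqr_ge0 x; have := sqr_ge0 y;
  rewrite /quad; lra. Qed.

Lemma quad_prod_le (R : realFieldType) (a b c : R) :
  0 <= a -> 0 <= b -> 0 <= c -> a + b + c = 1 ->
  quad b c * quad c a * quad a b <= 3 / 64.
Proof.
move=> a0 b0 c0 abc1.
pose q := a * b + b * c + c * a; pose r := a * b * c.
have ec : c = 1 - a - b by lra.
have PE : quad b c * quad c a * quad a b = q ^+ 2 - q ^+ 3 - r.
  by rewrite /quad /q /r ec; ring.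
have r0 : 0 <= r by rewrite /r !mulr_ge0.
have q0 : 0 <= q by rewrite /q !addr_ge0 ?mulr_ge0.
have q3 : q <= 1 / 3.
  have := sqr_ge0 (a - b); have := sqr_ge0 (b - c); have := sqr_ge0 (c - a).
  by rewrite /q ec; lra.
have rq : (4 * q - 1) / 9 <= r.
  by have := schur a0 b0 c0; rewrite /q /r ec; lra.
have gapE : 3 / 64 - (q ^+ 2 - q ^+ 3 - r)
          = (1 / 4 - q) * (3 / 16 + 3 / 4 * q - q ^+ 2) + r by field.
rewrite PE -subr_ge0 gapE.
have [q4|/ltW q4] := lerP q (1 / 4).
  by apply: addr_ge0 => //; apply: mulr_ge0; [lra | nra].
(* The slope 4/9 of Schur's bound exceeds the second factor on [1/4, 1/3]. *)
have : 0 <= (q - 1 / 4) * (4 / 9 - (3 / 16 + 3 / 4 * q - q ^+ 2)).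
  by apply: mulr_ge0; [lra | nra].
by lra.
Qed.

Lemma edist_sqr (R : realType) (n : nat) (p q : 'rV[R]_n) :
  edist p q ^+ 2 = \sum_(i < n) (p 0 i - q 0 i) ^+ 2.
Proof. by rewrite /edist sqr_sqrtr // sumr_ge0 // => i _; exact: sqr_ge0. Qed.

(** Expand p - A = b (B - A) + c (C - A) and eliminate the scalar product of
    B - A and C - A by the law of cosines. *)
Lemma edist_bary_sqr (R : realType) (n : nat) (A B C : 'rV[R]_n) (a b c : R) :
  a + b + c = 1 ->
  edist (a *: A + b *: B + c *: C) A ^+ 2
  = (b ^+ 2 + b * c) * edist A B ^+ 2 + (c ^+ 2 + b * c) * edist C A ^+ 2
    + - (b * c) * edist B C ^+ 2.
Proof.
move=> abc1; rewrite !edist_sqr !mulr_sumr -!big_split /=.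
apply: eq_bigr => i _; rewrite !mxE.
have -> : a = 1 - b - c by lra.
by ring.
Qed.

Lemma edist_bary (R : realType) (A B C : 'rV[R]_2) (l a b c : R) :
  0 <= l -> equilateral A B C l -> a + b + c = 1 ->
  edist (a *: A + b *: B + c *: C) A = l * Num.sqrt (quad b c).
Proof.
move=> l0 [AB BC CA] abc1; apply/eqP.
rewrite -(@eqrXn2 _ 2) ?mulr_ge0 ?sqrtr_ge0 //.
rewrite edist_bary_sqr // AB BC CA exprMn sqr_sqrtr ?quad_ge0 //.
by apply/eqP; rewrite /quad; ring.
Qed.

Lemma vertex_dist_prod_bary (R : realType) (A B C : 'rV[R]_2) (l a b c : R) :
  0 <= l -> equilateral A B C l -> a + b + c = 1 ->
  vertex_dist_prod A B C (a *: A + b *: B + c *: C)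
  = Num.sqrt (quad b c * quad c a * quad a b) * l ^+ 3.
Proof.
move=> l0 eqABC abc1; have [AB BC CA] := eqABC.
(* The distances to B and C are instances of the distance to A after a cyclic
   relabelling of the vertices. *)
have pB : edist (a *: A + b *: B + c *: C) B = l * Num.sqrt (quad c a).
  rewrite -addrA addrC; apply: edist_bary => //.
  by rewrite -abc1; ring.
have pC : edist (a *: A + b *: B + c *: C) C = l * Num.sqrt (quad a b).
  rewrite addrC addrA; apply: edist_bary => //.
  by rewrite -abc1; ring.
rewrite /vertex_dist_prod pB pC (edist_bary l0 eqABC abc1).
by rewrite !sqrtrM ?mulr_ge0 ?quad_ge0 //; ring.
Qed.

Lemma sqrt_3_64 (R : rcfType) : Num.sqrt (3 / 64 : R) = Num.sqrt 3 / 8.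
Proof.
have -> : 3 / 64 = 3 * (8^-1) ^+ 2 :> R by field.
by rewrite sqrtrM ?ler0n // sqrtr_sqr ger0_norm // invr_ge0 ler0n.
Qed.

Theorem mainTheorem3 (R : realType) (A B C : 'rV[R]_2) (l : R)
    (l_gt0 : 0 < l) (ABC_equilateral : equilateral A B C l) :
  let Delta := triangle A B C in
  let phi := vertex_dist_prod A B C in
  let M := Num.sqrt 3 / 8 * l ^+ 3 in
  is_maximum (phi @` Delta) M /\
  [/\ Delta (midpoint A B) /\ phi (midpoint A B) = M,
      Delta (midpoint B C) /\ phi (midpoint B C) = M
    & Delta (midpoint C A) /\ phi (midpoint C A) = M].
Proof.
move=> Delta phi M.
have l0 := ltW l_gt0.
have attained (a b c : R) (p : 'rV[R]_2) : 0 <= a -> 0 <= b -> 0 <= c ->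
    a + b + c = 1 -> quad b c * quad c a * quad a b = 3 / 64 ->
    p = a *: A + b *: B + c *: C -> Delta p /\ phi p = M.
  move=> a0 b0 c0 abc1 PE pE; split; first by exists a, b, c.
  by rewrite pE /phi (vertex_dist_prod_bary l0) // PE sqrt_3_64.
have half0 : 0 <= 2^-1 :> R by rewrite invr_ge0 ler0n.
have mAB : Delta (midpoint A B) /\ phi (midpoint A B) = M.
  apply: (attained 2^-1 2^-1 0) => //; [by field | by rewrite /quad; field |].
  by rewrite /midpoint scale0r addr0 scalerDr.
have mBC : Delta (midpoint B C) /\ phi (midpoint B C) = M.
  apply: (attained 0 2^-1 2^-1) => //; [by field | by rewrite /quad; field |].
  by rewrite /midpoint scale0r add0r scalerDr.
have mCA : Delta (midpoint C A) /\ phi (midpoint C A) = M.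
  apply: (attained 2^-1 0 2^-1) => //; [by field | by rewrite /quad; field |].
  by rewrite /midpoint scale0r addr0 scalerDr addrC.
split; last by [].
split; first by exists (midpoint A B); case: mAB.
move=> _ [p [a [b [c [[a0 b0 c0] abc1 ->]]]] <-].
rewrite /phi (vertex_dist_prod_bary l0) // /M -sqrt_3_64.
by rewrite ler_wpM2r ?exprn_ge0 // ler_wsqrtr // quad_prod_le.
Qed.
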